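(* Let $q$ be a Mersenne prime and let $e > 1$ be an even integer. Let $F = \mathbb{F}_q$ and $E = \mathbb{F}_{q^e}$ be the fields of orders $q$ and $q^e$ respectively, with $F \subseteq E$. Let $\pi$ be the set of primes dividing $q-1$, and let $\Gamma = \mathrm{Gal}(E/F)$. Let $C \leq E^\times$ be a subgroup such that the index $|E^\times : C|$ is a $\pi$-number and $4$ does not divide $|C|$. Let $G = C \rtimes \Gamma$. Then $$\mathrm{cd}(G) = \{\, n \mid n \text{ is a positive divisor of } e \,\} \setminus \{2\}.$$
   Context: A Mersenne prime is a prime of the form $2^p - 1$ with $p$ a positive integer (so $q = 3$ is allowed). $E^\times$ denotes the multiplicative group of nonzero elements of $E$. A positive integer is a $\pi$-number if every prime dividing it belongs to $\pi$ (so $1$ is a $\pi$-number). The semidirect product $C \rtimes \Gamma$ is formed with respect to the natural action of the Galois group $\Gamma$ on $C$ by field automorphisms; since $E^\times$ is cyclic, $C$ is invariant under $\Gamma$. For a finite group $G$, $\mathrm{Irr}(G)$ denotes the set of irreducible complex characters of $G$, and $\mathrm{cd}(G) = \{\chi(1) \mid \chi \in \mathrm{Irr}(G)\}$ is the set of their degrees. *)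

(* Defs.v *)
From HB Require Import structures.
From mathcomp Require Import all_boot all_order all_fingroup all_algebra.
From mathcomp Require Import all_solvable all_field all_character.

Set Implicit Arguments.
Unset Strict Implicit.
Unset Printing Implicit Defensive.

Import GRing.Theory.
Local Open Scope ring_scope.

Definition mersenne_prime (q : nat) : Prop :=
  prime q /\ exists2 p : nat, (0 < p)%N & q = (2 ^ p - 1)%N.

(* The degrees are kept as elements of algC, where characters take values. *)
Definition cd (gT : finGroupType) (G : {group gT}) : seq algC :=
  [seq 'chi[G]_i 1%g | i : Iirr G].

(* [finvect_type E] is the finite extension E, viewed both as a finite field
   (so that its unit group is a finite group) and as a splitting field over F
   (so that its Galois groups are defined). *)
Section GaloisActionOnUnits.

Variables (F : finFieldType) (E : fieldExtType F).
Local Notation L := (finvect_type E).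
Local Notation aT := (gal_of {:L}).

Lemma gal_unitP (u : {unit L}) (a : aT) : a (val u) \is a GRing.unit.
Proof. exact: rmorph_unit (valP u). Qed.

Definition gal_unit (u : {unit L}) (a : aT) : {unit L} :=
  FinRing.Unit (gal_unitP u a).

Lemma gal_unit1 : gal_unit^~ 1%g =1 id.
Proof. by move=> u; apply: val_inj; rewrite /= gal_id. Qed.

Lemma gal_unitM (u : {unit L}) : act_morph gal_unit u.
Proof. by move=> a b; apply: val_inj; rewrite /= galM ?memvf. Qed.

Canonical gal_unit_action := TotalAction gal_unit1 gal_unitM.

Lemma gal_unit_is_groupAction : is_groupAction [set: {unit L}] gal_unit_action.
Proof.
move=> a _; rewrite inE; apply/andP; split.
  by apply/subsetP=> u _; rewrite inE.
apply/morphicP=> u v _ _; rewrite !actpermE /=.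
by apply: val_inj; rewrite /= rmorphM.
Qed.

Canonical gal_unit_groupAction := GroupAction gal_unit_is_groupAction.

Lemma gal_unit_acts_on (C : {group {unit L}}) :
  acts_on_group 'Gal({:L} / 1) C gal_unit_groupAction.
Proof.
split; last exact: subsetT.
have /andP[_ /forall_inP Cchar] : (C \char [set: {unit L}])%g.
  by rewrite sub_cyclic_char ?subsetT // field_unit_group_cyclic.
apply/subsetP=> a _; rewrite !inE /=; apply/subsetP=> u Cu; rewrite inE.
have /Cchar/subsetP := gal_unit_is_groupAction (in_setT a).
by move/(_ _ (imset_f _ Cu)); rewrite actpermE.
Qed.

Definition gal_sdprod (C : {group {unit L}}) : finGroupType :=
  sdprod_by <[gal_unit_acts_on C]>%gact.

End GaloisActionOnUnits.

(* Main.v *)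
Require Import Defs.
From mathcomp Require Import all_boot all_order all_fingroup all_algebra.
From mathcomp Require Import all_solvable all_field all_character.
From mathcomp Require Import zify ring.

Set Implicit Arguments.
Unset Strict Implicit.
Unset Printing Implicit Defensive.

Import GRing.Theory.
Local Open Scope ring_scope.

(** Write C = <[x]> and let s be the Frobenius automorphism, so that G is the
    semidirect product of <[x]> by <[s]> with x ^ s = x ^+ q.  Since C is
    abelian and G / C is cyclic, every irreducible character of G is induced
    from a linear character of the inertia group of some lambda in Irr(C), so
    cd(G) is the set of indices of these inertia groups
    ([cd_cyclic_quotient]).  If lambda has order d, that is, if lambda x is a
    primitive d-th root of unity, then s ^+ k fixes lambda exactly when d
    divides q ^ k - 1; hence the index is the multiplicative order of q modulo
    d.  As d ranges over all divisors of #|C|, cd(G) is the set of orders of q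
    modulo divisors of #|C| ([cd_sdprod_cycle]).  These orders divide e because
    #|C| divides q ^ e - 1.

    The order 2 does not occur: if d divides q ^ 2 - 1 = (q - 1)(q + 1), where
    q + 1 is a power of 2, and 4 does not divide d, then d already divides
    q - 1 ([mersenne_dvd_sqr]).

    Every other divisor n of e occurs ([exists_order_eq]).  For n = 1 take
    d = 1; for n > 2 take d = gcd(#|C|, q ^ n - 1).  If the order of q modulo d
    were smaller than n, it would divide n / l for some prime l dividing n, so
    that d would divide q ^ (n / l) - 1.  This is impossible as soon as some
    prime r not dividing q - 1, which may depend on l, divides the quotient Q
    of q ^ n - 1 by q ^ (n / l) - 1: such an r does not divide the index of C,
    so the r-part of d is the whole r-part of q ^ n - 1, which is strictly
    larger than that of q ^ (n / l) - 1.  Now Q = 1 + y + ... + y ^ (l - 1)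
    with y = q ^ (n / l), and y = 1 modulo every prime divisor of q - 1, so l
    is the only prime divisor of q - 1 that can divide Q.  If r did not exist,
    Q would be a power of l, with l dividing q - 1.  For odd l this fails
    because Q > l while Q = l modulo l ^ 2; for l = 2 it fails because
    Q = q ^ (n / 2) + 1 with n / 2 > 1 is not a power of 2
    ([geom_sum_not_pi]). *)

(** * Multiplicative orders of a Mersenne prime *)

Section Arithmetic.

Local Open Scope nat_scope.

Lemma geom_sum_mod r l x : x = 1 %[mod r] -> \sum_(i < l) x ^ i = l %[mod r].
Proof.
move=> x1; rewrite -modn_summ -[in RHS](card_ord l) -sum1_card -[RHS]modn_summ.
by congr (_ %% _); apply: eq_bigr => i _; rewrite -modnXm x1 modnXm exp1n.
Qed.

(** With x = a l + 1, the power x ^ i is 1 + i a l modulo l ^ 2, and the linear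
    terms add up to a l 'C(l, 2), a multiple of l ^ 2 since l is odd. *)
Lemma geom_sum_mod_sqr l a : odd l ->
  \sum_(i < l) (a * l).+1 ^ i = l %[mod l ^ 2].
Proof.
move=> odd_l; set x := (a * l).+1.
have xi i : x ^ i = 1 + i * (a * l) %[mod l ^ 2].
  elim: i => // i IHi; rewrite expnS -modnMmr IHi modnMmr.
  rewrite (_ : x * _ = (a * i * a) * l ^ 2 + (1 + i.+1 * (a * l))) ?modnMDl //.
  by rewrite /x; ring.
rewrite -modn_summ (eq_bigr _ (fun (i : 'I_l) _ => xi i)) modn_summ big_split /=.
rewrite sum1_card card_ord -big_distrl /= -(big_mkord xpredT id) bin2_sum.
have -> : 'C(l, 2) * (a * l) = (l.-1./2 * a) * l ^ 2.
  by rewrite bin2odd // -mulnn; ring.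
by rewrite addnC modnMDl.
Qed.

(** Modulo 2 ^ (p + 1) the square of q is 1, so q ^ k + 1 is q + 1 = 2 ^ p or 2
    according to the parity of k, and never 0; but 2 ^ j is 0, as j > p. *)
Lemma mersenne_exp_succ q p k j : q.+1 = 2 ^ p -> 1 < q -> 1 < k ->
  (q ^ k).+1 <> 2 ^ j.
Proof.
move=> Dq q_gt1 k_gt1 Eqk; have p_gt0 : 0 < p by case: p Dq => //; lia.
have lt_pj : p < j.
  by rewrite -(ltn_exp2l p j (isT : 1 < 2)) -Eqk -Dq ltnS -[ltnLHS]expn1 ltn_exp2l.
have q2 : q ^ 2 = 1 %[mod 2 ^ p.+1].
  have -> : q ^ 2 = q ^ 2 + 2 ^ p.+1 %[mod 2 ^ p.+1] by rewrite modnDr.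
  have -> : q ^ 2 + 2 ^ p.+1 = 2 ^ p.-1 * 2 ^ p.+1 + 1.
    have -> : 2 ^ p.-1 * 2 ^ p.+1 = (2 ^ p) ^ 2.
      by rewrite -expnD -expnM; congr (_ ^ _); lia.
    by rewrite [2 ^ p.+1]expnS -Dq; ring.
  by rewrite modnMDl.
have lt_2p1 : 2 < 2 ^ p.+1 by rewrite expnS -Dq; lia.
have: (q ^ k).+1 = (if odd k then 2 ^ p else 2) %[mod 2 ^ p.+1].
  rewrite -{1}[k]odd_double_half -mul2n expnD expnM -addn1 -modnDml -modnMmr.
  rewrite -modnXm q2 modnXm exp1n modnMmr muln1 modnDml addn1.
  by case: (odd k); rewrite ?expn1 ?Dq.
rewrite Eqk -(subnK lt_pj) expnD modnMl modn_small; last first.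
  by case: ifP; rewrite ?ltn_exp2l.
by case: ifP => // _ /esym/eqP; rewrite expn_eq0.
Qed.

(** The sum is the quotient of q ^ n - 1 by q ^ (n / l) - 1.  It is l modulo
    every prime divisor of q - 1, so if it had no other prime divisors it would
    be a power of l.  The bound n > 2 is what excludes q + 1, a power of 2. *)
Lemma geom_sum_not_pi q n l :
    mersenne_prime q -> 2 < n -> prime l -> l %| n ->
  ~~ \pi(q - 1).-nat (\sum_(i < l) (q ^ (n %/ l)) ^ i).
Proof.
move=> [pr_q [p p_gt0 Dq]] n_gt2 pr_l l_dvd_n; apply/negP.
set x := q ^ (n %/ l); set Phi := \sum_(i < l) _ => piPhi.
have q_gt1 := prime_gt1 pr_q; have l_gt1 := prime_gt1 pr_l.
have k_gt0 : 0 < n %/ l by rewrite divn_gt0 ?prime_gt0 // dvdn_leq //; lia.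
have x_gt1 : 1 < x by rewrite -(exp1n (n %/ l)) ltn_exp2r.
have x_mod r : r %| q - 1 -> x = 1 %[mod r].
  move=> r_dvd; have /eqP q1 : q == 1 %[mod r] by rewrite eqn_mod_dvd // ltnW.
  by rewrite /x -modnXm q1 modnXm exp1n.
have Phi_gt_l : l < Phi.
  rewrite /Phi -(subnK l_gt1) addnC !big_ord_recl /= expn0 expn1.
  set S := \sum_(i < _) _; have: l - 2 <= S.
    rewrite -[l - 2]card_ord -sum1_card; apply: leq_sum => i _.
    by rewrite expn_gt0 ltnW.
  by move: x_gt1 l_gt1; lia.
have /p_natP[j DPhi] : l.-nat Phi.
  apply/pnatP=> [|r pr_r r_dvd]; first exact: leq_trans Phi_gt_l.
  have /x_mod/(geom_sum_mod l)/eqP : r %| q - 1.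
    have: r \in \pi(q - 1).
      apply: (pnatPpi piPhi); rewrite mem_primes pr_r r_dvd andbT.
      exact: leq_trans Phi_gt_l.
    by rewrite mem_primes => /and3P[].
  rewrite -/Phi (eqP (r_dvd : Phi %% r == 0)) eq_sym.
  by rewrite -[_ == _]/(r %| l) dvdn_prime2.
have j_gt1 : 1 < j by rewrite -(ltn_exp2l 1 j l_gt1) -DPhi expn1.
have l_dvd_q1 : l %| q - 1.
  have: l \in \pi(q - 1).
    apply: (pnatPpi piPhi); rewrite DPhi mem_primes pr_l expn_gt0 prime_gt0 //=.
    by rewrite dvdn_exp // ltnW.
  by rewrite mem_primes => /and3P[].
have [l2 | odd_l] := even_prime pr_l; last first.
  have /eqP := x_mod l l_dvd_q1; rewrite eqn_mod_dvd ?(ltnW x_gt1) // => /dvdnP[a].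
  move=> Da; have := geom_sum_mod_sqr a odd_l; rewrite -Da subn1 prednK ?(ltnW x_gt1) //.
  rewrite -/Phi DPhi -(subnK j_gt1) expnD modnMl => /esym/eqP.
  by rewrite modn_small -?mulnn ?ltn_Pmull ?prime_gt0 // (gtn_eqF (prime_gt0 pr_l)).
apply: (@mersenne_exp_succ q p (n %/ l) j) => //.
- by rewrite Dq subn1 prednK ?expn_gt0.
- by rewrite ltn_divRL // l2; lia.
by rewrite -/x -l2 -DPhi /Phi l2 !big_ord_recl big_ord0 /= expn0 expn1 addn0 add1n.
Qed.

(** As q + 1 is a power of 2, the odd part of d divides q - 1; the 2-part of d
    is at most 2, and q - 1 is even. *)
Lemma mersenne_dvd_sqr q d :
  mersenne_prime q -> ~~ (4 %| d) -> d %| q ^ 2 - 1 -> d %| q - 1.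
Proof.
move=> [pr_q [p p_gt0 Dq]] n4d; have q_gt1 := prime_gt1 pr_q.
have q1_even : 2 %| q - 1.
  by rewrite dvdn2 Dq -subnDA oddB ?oddX //= -?expnS ?(@leq_exp2l 2 1) ?eqn0Ngt ?p_gt0.
have -> : q ^ 2 - 1 = (q - 1) * 2 ^ p.
  have -> : 2 ^ p = q + 1 by rewrite Dq subnK ?expn_gt0.
  by rewrite -(subn_sqr q 1).
have oddP m : odd m -> m %| (q - 1) * 2 ^ p -> m %| q - 1.
  by move=> odd_m; rewrite Gauss_dvdl // coprimeXr // coprimen2.
have [odd_d | even_d] := boolP (odd d); first exact: oddP.
have Dd : d = (d./2 * 2)%N by rewrite muln2 -[LHS]odd_double_half (negPf even_d).
have odd_d2 : odd d./2.
  apply: contraR n4d => even_d2; rewrite Dd.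
  by rewrite -[d./2]odd_double_half (negPf even_d2) -muln2 add0n -mulnA dvdn_mull.
move=> d_dvd; rewrite Dd Gauss_dvd ?coprimen2 // q1_even andbT.
by apply: oddP => //; apply: dvdn_trans d_dvd; rewrite [X in _ %| X]Dd dvdn_mulr.
Qed.

Lemma dvdn_exp_sub1_gcd q d m n :
    0 < q -> d %| q ^ m - 1 -> d %| q ^ n - 1 ->
  d %| q ^ gcdn m n - 1.
Proof.
move=> q_gt0; case: m => [|m]; first by rewrite gcd0n.
rewrite -!eqn_mod_dvd ?expn_gt0 ?q_gt0 // => /eqP qm /eqP qn.
have [a _ /dvdnP[b Dg]] := Bezoutl n (ltn0Sn m).
have qan : q ^ (a * n) = 1 %[mod d] by rewrite mulnC expnM -modnXm qn modnXm exp1n.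
have : q ^ (gcdn m.+1 n + a * n) = 1 %[mod d].
  by rewrite Dg mulnC expnM -modnXm qm modnXm exp1n.
by rewrite expnD -modnMmr qan modnMmr muln1 => ->.
Qed.

Lemma dvdn_exp_sub1 q m n : m %| n -> q ^ m - 1 %| q ^ n - 1.
Proof.
by case/dvdnP=> k ->; rewrite mulnC expnM !subn1 [X in _ %| X]predn_exp dvdn_mulr.
Qed.

(** This conclusion says that q has order n modulo d.  The choice is
    d = gcd(D, q ^ n - 1), the largest divisor of D modulo which the order
    of q divides n. *)
Lemma exists_order_eq q e n D :
    mersenne_prime q -> 2 < n -> n %| e -> 0 < e ->
    D %| q ^ e - 1 -> \pi(q - 1).-nat ((q ^ e - 1) %/ D) ->
  exists2 d, d %| D & forall k, (n %| k) = (d %| q ^ k - 1).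
Proof.
move=> mq n_gt2 n_dvd_e e_gt0 DN piD; have q_gt1 : 1 < q by case: mq => /prime_gt1.
have gt0 k : 0 < k -> 0 < q ^ k - 1.
  by move=> k_gt0; rewrite subn_gt0 -(exp1n k) ltn_exp2r.
have n_gt0 : 0 < n by lia.
set d := gcdn D (q ^ n - 1); have d_dvd_qn : d %| q ^ n - 1 by apply: dvdn_gcdr.
exists d => [|k]; first exact: dvdn_gcdl.
apply/idP/idP=> [n_dvd_k | d_dvd_qk].
  exact: dvdn_trans d_dvd_qn (dvdn_exp_sub1 q n_dvd_k).
have d_dvd_qg := dvdn_exp_sub1_gcd (ltnW q_gt1) d_dvd_qk d_dvd_qn.
have g_dvd_n := dvdn_gcdr k n; set g := gcdn k n in d_dvd_qg g_dvd_n.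
have g_gt0 : 0 < g by apply: dvdn_gt0 g_dvd_n.
have [ng1 | ng_neq1] := eqVneq (n %/ g) 1.
  by rewrite -(divnK g_dvd_n) ng1 mul1n dvdn_gcdl.
have /pdivP[l pr_l l_dvd_ng] : 1 < n %/ g.
  by rewrite ltn_neqAle eq_sym ng_neq1 divn_gt0 // dvdn_leq.
have l_dvd_n : l %| n by rewrite (dvdn_trans l_dvd_ng) ?dvdn_div.
have k_gt0 : 0 < n %/ l by rewrite divn_gt0 ?prime_gt0 // dvdn_leq.
have d_dvd_qnl : d %| q ^ (n %/ l) - 1.
  apply: dvdn_trans d_dvd_qg (dvdn_exp_sub1 q _).
  rewrite -(dvdn_pmul2r (prime_gt0 pr_l)) divnK // mulnC.
  by rewrite -[X in _ %| X](divnK g_dvd_n) dvdn_mul.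
have Dqn : q ^ n - 1 = (q ^ (n %/ l) - 1) * \sum_(i < l) (q ^ (n %/ l)) ^ i.
  by rewrite !subn1 -predn_exp -expnM divnK.
have Phi_gt0 : 0 < \sum_(i < l) (q ^ (n %/ l)) ^ i.
  by move: (gt0 n n_gt0); rewrite Dqn muln_gt0 => /andP[].
case/negP: (geom_sum_not_pi mq n_gt2 pr_l l_dvd_n); apply/pnatP=> // r pr_r r_dvd.
apply/idPn=> r'q.
(* Outside the primes of q - 1, the integers D and q ^ e - 1 have the same
   local parts. *)
have logD : logn r D = logn r (q ^ e - 1).
  rewrite -[in RHS](divnK DN) lognM ?(dvdn_gt0 _ DN) ?gt0 //; last by case/andP: piD.
  rewrite [logn r (_ %/ _)]logn_coprime ?add0n // prime_coprime //.
  apply: contra r'q => r_dvd2; apply: (pnatPpi piD); rewrite mem_primes pr_r r_dvd2.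
  by case/andP: piD => ->.
have log_qn : logn r (q ^ n - 1) <= logn r (q ^ e - 1).
  by rewrite dvdn_leq_log ?gt0 // dvdn_exp_sub1.
have := dvdn_leq_log r (gt0 _ k_gt0) d_dvd_qnl.
rewrite logn_gcd ?gt0 ?(dvdn_gt0 _ DN) ?gt0 // logD (minn_idPr log_qn).
rewrite Dqn lognM ?gt0 // -[leqRHS]addn0 leq_add2l leqNgt => /negP[].
by rewrite logn_gt0 mem_primes pr_r Phi_gt0.
Qed.

End Arithmetic.

(** * Character degrees over a cyclic normal subgroup *)

(** A linear character of <[x]> is determined by its value at x.  So the
    #[x] irreducible characters take #[x] distinct values at x, and these
    exhaust the #[x]-th roots of unity. *)
Lemma cyclic_irr_value (gT : finGroupType) (C : {group gT}) x (z : algC) :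
  C :=: <[x]>%g -> z ^+ #[x]%g = 1 -> exists i : Iirr C, 'chi_i x = z.
Proof.
move=> defC zx1; have Cx : x \in C by rewrite defC cycle_id.
have cycC : cyclic C by rewrite defC cycle_cyclic.
have linC i : 'chi[C]_i \is a linear_char by apply: irr_cyclic_lin.
pose vals := [seq 'chi[C]_i x | i : Iirr C].
have [/imageP[i _ ->]|] := boolP (z \in vals); first by exists i.
move=> z_new; suff: (size (z :: vals) <= #[x]%g)%N.
  by rewrite /= size_image card_Iirr_abelian ?cyclic_abelian // orderE -defC ltnn.
apply: max_unity_roots; rewrite ?order_gt0 //=.
  rewrite unity_rootE zx1 eqxx; apply/allP=> _ /imageP[i _ ->].
  by rewrite unity_rootE lin_char_unity_root.
rewrite z_new; apply/injectiveP=> i j /= eq_ij; apply/irr_inj/cfun_inP=> y Cy.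
have /cycleP[k ->] : y \in <[x]>%g by rewrite -defC.
by rewrite !lin_charX // eq_ij.
Qed.

(** Let K be the kernel of the invariant linear character lambda of N.  By
    invariance K is normal in G and [N, G] lies in K, so N / K is central in
    G / K with cyclic quotient; hence G / K is abelian.  Since K also lies in
    the kernel of every irreducible character over lambda, these characters
    are linear. *)
Lemma irr_Ind_invariant_lin (gT : finGroupType) (N G : {group gT}) t s :
    (N <| G)%g -> cyclic (G / N)%g -> 'chi[N]_t \is a linear_char ->
    G \subset 'I['chi_t]%g -> s \in irr_constt ('Ind[G] 'chi_t) ->
  'chi_s \is a linear_char.
Proof.
move=> nsNG cycGN lin_t IGt Gs; have [sNG nNG] := andP nsNG.
pose K := cfker_group 'chi_t; have sKN : K \subset N by apply: cfker_sub.
have tJ x y : y \in G -> 'chi_t (x ^ y)%g = 'chi_t x.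
  by move/(subsetP IGt); apply: inertia_valJ.
have nsKG : (K <| G)%g.
  rewrite /normal (subset_trans sKN sNG); apply/subsetP=> y Gy.
  by rewrite inE -cfker_conjg ?(subsetP nNG) // inertiaJ ?(subsetP IGt).
have nKG := normal_norm nsKG.
have cNG : (N / K \subset 'Z(G / K))%g.
  rewrite subsetI quotientS // quotient_cents2r // gen_subG.
  apply/subsetP=> _ /imset2P[x y Nx Gy ->].
  have Nxy : (x ^ y)%g \in N by rewrite memJ_norm // (subsetP nNG).
  rewrite commgEl /= cfkerEirr inE.
  by rewrite lin_charM ?groupV // tJ // -lin_charM ?groupV // mulVg.
rewrite lin_irr_der1; apply: (@subset_trans _ _ (mem K)).
  rewrite der1_min // (cyclic_factor_abelian cNG) //.
  by rewrite (isog_cyclic (third_isog sKN nsKG nsNG)).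
apply: subset_trans (cfker_constt _ Gs); last by rewrite cfInd_char ?irr_char.
by rewrite cfker_Ind_irr // sub_gcore.
Qed.

(** The Clifford correspondence: every irreducible character over lambda is
    induced from the inertia group T of lambda, where the characters over
    lambda are linear; its degree is therefore the index of T. *)
Lemma cd_cyclic_quotient (gT : finGroupType) (N G : {group gT}) (a : algC) :
    (N <| G)%g -> abelian N -> cyclic (G / N)%g ->
  reflect (exists t : Iirr N, a = #|G : 'I_G['chi_t]|%g%:R) (a \in cd G).
Proof.
move=> nsNG abN cycGN; have [sNG nNG] := andP nsNG.
have deg t s : s \in irr_constt ('Ind['I_G['chi[N]_t]] 'chi_t) ->
  ('Ind[G] 'chi_s \in irr G) /\ 'Ind[G] 'chi_s 1%g = #|G : 'I_G['chi_t]|%g%:R.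
  move=> Ts; have [irrInd _ _ _ _] := constt_Inertia_bijection t nsNG.
  split; first exact: irrInd.
  rewrite cfInd1 ?Inertia_sub // lin_char1 ?mulr1 //.
  apply: irr_Ind_invariant_lin Ts; rewrite ?normal_Inertia ?subsetIr //.
    by apply: cyclicS cycGN; rewrite quotientS ?Inertia_sub.
  exact/char_abelianP.
apply: (iffP imageP) => [[i _ ->] | [t ->]].
  have [t it] := constt_cfRes_irr N i; exists t.
  have [_ _ imB _ _] := constt_Inertia_bijection t nsNG.
  have /imsetP[s Ts ->] : i \in Ind_Iirr G @: irr_constt ('Ind['I_G['chi_t]] 'chi_t).
    by rewrite imB constt_Ind_Res.
  by have [irrs <-] := deg t s Ts; rewrite cfIirrE.
have [s Ts] := constt_cfInd_irr t (sub_Inertia 'chi_t sNG).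
by have [irrs <-] := deg t s Ts; exists (Ind_Iirr G s); rewrite ?cfIirrE.
Qed.

Lemma mem_cycle_subgroup (gT : finGroupType) (s : gT) (K : {group gT}) k :
  K \subset <[s]>%g -> (s ^+ k \in K)%g = (#|<[s]> : K|%g %| k)%N.
Proof.
move=> sKs; have nKs : s \in 'N(K)%g.
  rewrite -cycle_subG cents_norm //.
  by rewrite (subset_trans _ (centS sKs)) // -/(abelian _) cycle_abelian.
have {1}-> : (s ^+ k \in K)%g = (coset K s ^+ k == 1)%g.
  by rewrite -morphX //; apply/idP/eqP=> [/coset_id //|]; apply: coset_idr; rewrite groupX.
rewrite -order_dvdn orderE -quotient_cycle // card_quotient //.
by rewrite cycle_subG.
Qed.

Lemma index_sdprod_sub (gT : finGroupType) (N H G T : {group gT}) :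
  (N ><| H = G)%g -> N \subset T -> T \subset G -> #|G : T|%g = #|H : H :&: T|%g.
Proof.
move=> defG sNT sTG; have /mulG_sub[_ sHG] := sdprodW defG.
have defTH : (T * H = G)%g.
  apply/eqP; rewrite eqEsubset mul_subG //=.
  by rewrite -(sdprodW defG) mulSg.
have := mul_cardG T H; rewrite defTH -(Lagrange sTG) -(Lagrange (subsetIl H T)).
rewrite [T :&: H]setIC -mulnA => /eqP; rewrite eqn_pmul2l ?cardG_gt0 // mulnC.
by rewrite eqn_pmul2r ?cardG_gt0 // => /eqP.
Qed.

(** Taking the index inside <[s]> turns the left-hand side into the condition
    that s ^+ k fixes lambda, which it suffices to test at the generator x. *)
Lemma dvdn_inertia_index (gT : finGroupType) (N G : {group gT}) x s q t k :
    N :=: <[x]>%g -> (N ><| <[s]> = G)%g -> (x ^ s = x ^+ q)%g ->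
  (#|G : 'I_G['chi[N]_t]|%g %| k)%N = ('chi_t x ^+ (q ^ k) == 'chi_t x).
Proof.
move=> defN defG xs; have [_ sHG _ nNH _] := sdprod_context defG.
have Nx : x \in N by rewrite defN cycle_id.
have lin_t : 'chi[N]_t \is a linear_char.
  by rewrite irr_cyclic_lin // defN cycle_cyclic.
have sNG : N \subset G by case/sdprod_context: defG => /andP[].
have sksH := mem_cycle s k.
rewrite (index_sdprod_sub defG) ?Inertia_sub ?sub_Inertia //.
rewrite -mem_cycle_subgroup ?subsetIl // 2!inE sksH (subsetP sHG) //=.
have xsk : (x ^ (s ^+ k) = x ^+ (q ^ k))%g.
  elim: (k) => [|m IHm]; first by rewrite conjg1 expg1.
  by rewrite expgSr conjgM IHm conjXg xs -expgM expnS.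
rewrite -lin_charX // -xsk; apply/idP/eqP=> [|tx]; first exact: inertia_valJ.
have nNsk : (s ^+ k \in 'N(N))%g by apply: (subsetP nNH).
rewrite inE nNsk; apply/eqP/cfun_inP=> z.
rewrite -(memJ_norm _ (groupVr nNsk)) cfConjgE // => Nz.
rewrite -{2}(conjgKV (s ^+ k)%g z); set y := (z ^ _)%g in Nz *.
have /cycleP[j ->] : y \in <[x]>%g by rewrite -defN.
by rewrite conjXg !lin_charX ?memJ_norm ?tx.
Qed.

(** The condition on f says that f is the order of q modulo d; here d is the
    order of the root of unity lambda x. *)
Lemma cd_sdprod_cycle (gT : finGroupType) (N G : {group gT}) x s q a :
    N :=: <[x]>%g -> (N ><| <[s]> = G)%g -> (x ^ s = x ^+ q)%g -> (0 < q)%N ->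
  reflect (exists2 d, (d %| #|N|)%N &
           exists2 f, (forall k, (f %| k) = (d %| q ^ k - 1))%N & a = f%:R)
          (a \in cd G).
Proof.
move=> defN defG xs q_gt0; have [nsNG sHG _ nNH _] := sdprod_context defG.
have Nx : x \in N by rewrite defN cycle_id.
have cycN : cyclic N by rewrite defN cycle_cyclic.
have oN : #|N| = #[x]%g by rewrite orderE -defN.
have cycGN : cyclic (G / N)%g.
  by rewrite -(isog_cyclic (sdprod_isog defG)) cycle_cyclic.
have indexP t d k : d.-primitive_root ('chi[N]_t x) ->
    (#|G : 'I_G['chi_t]|%g %| k)%N = (d %| q ^ k - 1)%N.
  move=> pr_t; rewrite (dvdn_inertia_index _ _ defN defG xs).
  by rewrite -[X in _ == X]expr1 (eq_prim_root_expr pr_t) eqn_mod_dvd ?expn_gt0 ?q_gt0.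
apply: (iffP (cd_cyclic_quotient a nsNG (cyclic_abelian cycN) cycGN)).
  case=> t ->; have lin_t := irr_cyclic_lin t cycN.
  have [d pr_d d_dvd] := prim_order_exists (order_gt0 x) (lin_char_unity_root lin_t Nx).
  by exists d; rewrite ?oN //; exists #|G : 'I_G['chi_t]|%g => // k; apply: indexP.
case=> d d_dvd [f f_dvd ->]; have d_gt0 : (0 < d)%N := dvdn_gt0 (cardG_gt0 N) d_dvd.
have [z pr_z] := C_prim_root_exists d_gt0.
have [t tx] : exists t : Iirr N, 'chi_t x = z.
  apply: cyclic_irr_value => //; apply/eqP.
  by rewrite -(prim_order_dvd pr_z) -oN.
have idx k := indexP t d k; rewrite tx in idx.
exists t; congr _%:R; apply/eqP.
by rewrite eqn_dvd f_dvd -idx // dvdnn idx // -f_dvd dvdnn.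
Qed.

(** * The action of the Frobenius automorphism *)

Section GaloisSdprod.

Variables (F : finFieldType) (E : fieldExtType F).
Local Notation L := (finvect_type E).

(** The Galois group is generated by the Frobenius automorphism, the #|F|-th
    power map, so inside the semidirect product its generator s conjugates
    every element of the cyclic group C to its #|F|-th power. *)
Lemma gal_sdprod_struct (C : {group {unit L}}) :
  exists (N : {group gal_sdprod C}) x s,
   [/\ #|N| = #|C|, N :=: <[x]>%g, (N ><| <[s]> = [set: gal_sdprod C])%g
     & (x ^ s = x ^+ #|F|)%g].
Proof.
have /cyclicP[c defC] : cyclic C by apply: field_unit_group_cyclic.
have [al /eqP gen_al alE] := finField_galois_generator (sub1v {:L}%AS).
pose to := <[gal_unit_acts_on C]>%gact.
have Cc : c \in C by rewrite defC cycle_id.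
have Gal : al \in 'Gal({:L} / 1)%g by rewrite gen_al cycle_id.
exists (sdpair1 to @* C)%G, (sdpair1 to c), (sdpair2 to al); split.
- by rewrite card_injm ?injm_sdpair1.
- by rewrite -morphim_cycle // -defC.
- by rewrite -[RHS](sdprod_sdpair to) -morphim_cycle // -gen_al.
rewrite -sdpair_act // -morphX //; congr sdpair1.
rewrite /= actbyE //; apply: val_inj; rewrite /= alE ?memvf // dimv1 expn1.
by rewrite FinRing.val_unitX.
Qed.

End GaloisSdprod.

(** * The degrees of the semidirect product *)

Theorem mainTheorem1 (q e : nat) (q_mersenne : mersenne_prime q)
    (e_gt1 : (1 < e)%N) (e_even : ~~ odd e)
    (F : finFieldType) (E : fieldExtType F)
    (cardF : #|F| = q) (cardE : #|finvect_type E| = (q ^ e)%N)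
    (C : {group {unit (finvect_type E)}})
    (indexC : \pi((q - 1)%N).-nat #|[set: {unit (finvect_type E)}] : C|%g)
    (four_ndvdC : ~~ (4 %| #|C|)%N) :
  cd [set: gal_sdprod C]%G =i
    [seq n%:R : algC | n <- divisors e & n != 2%N].
Proof.
have [N [x [s [oN defN defG xs]]]] := gal_sdprod_struct C.
rewrite cardF in xs; have q_gt0 : (0 < q)%N by case: q_mersenne => /prime_gt0.
have e_gt0 := ltnW e_gt1; have oL : #|[set: {unit (finvect_type E)}]| = (q ^ e - 1)%N.
  by rewrite card_finField_unit cardE subn1.
have C_dvd : (#|C| %| q ^ e - 1)%N by rewrite -oL cardSg ?subsetT.
have piC : \pi((q - 1)%N).-nat ((q ^ e - 1) %/ #|C|)%N.
  by rewrite -oL divgS ?subsetT.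
move=> a; apply/(cd_sdprod_cycle _ defN defG xs q_gt0)/mapP.
  rewrite oN => -[d d_dvd [f fP ->]]; exists f => //.
  rewrite mem_filter -dvdn_divisors // fP (dvdn_trans d_dvd) // andbT.
  apply/eqP=> f2; suff: (2 %| 1)%N by [].
  rewrite -f2 fP expn1 (mersenne_dvd_sqr q_mersenne) -?fP ?f2 //.
  by apply: contra four_ndvdC => /dvdn_trans->.
case=> n; rewrite mem_filter -dvdn_divisors // oN => /andP[n_neq2 n_dvd_e] ->.
have [n1 | n_neq1] := eqVneq n 1%N.
  by exists 1%N; [exact: dvd1n | exists 1%N; rewrite ?n1 // => k; rewrite !dvd1n].
have n_gt2 : (2 < n)%N by have := dvdn_gt0 e_gt0 n_dvd_e; lia.
have [d d_dvd dP] := exists_order_eq q_mersenne n_gt2 n_dvd_e e_gt0 C_dvd piC.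
by exists d => //; exists n.
Qed.
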